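(* Let $Q=(q_{ij})$ be a real $m\times n$ matrix, $c\in\mathbb{R}^m$, $d\in\mathbb{R}^n$, and let $x\in[0,1]^m$, $y\in[0,1]^n$. Define $y^*\in\{0,1\}^n$ and then $x^*\in\{0,1\}^m$ by $$y^*_j=\begin{cases}1&\text{if } d_j+\sum_{i=1}^m q_{ij}x_i>0,\\0&\text{otherwise,}\end{cases}\qquad x^*_i=\begin{cases}1&\text{if } c_i+\sum_{j=1}^n q_{ij}y^*_j>0,\\0&\text{otherwise.}\end{cases}$$ Then $f(x^*,y^* )\ge f(x,y)$.
   Context: For $x\in[0,1]^m$ and $y\in[0,1]^n$, $f(x,y)=\sum_{i=1}^m\sum_{j=1}^n q_{ij}x_iy_j+\sum_{i=1}^m c_ix_i+\sum_{j=1}^n d_jy_j$. The construction of $(x^*,y^* )$ from $(x,y)$ is called the round-$y$ optimize-$x$ (RyOx) algorithm. *)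

(* Defs.v *)
From HB Require Import structures.
From mathcomp Require Import all_boot all_order all_algebra.
Set Implicit Arguments.
Unset Strict Implicit.
Unset Printing Implicit Defensive.
Import Order.TTheory GRing.Theory Num.Theory.
Local Open Scope ring_scope.

Definition in_unit_cube (R : realFieldType) (k : nat) (v : 'cV[R]_k) : Prop :=
  forall i : 'I_k, 0 <= v i 0 <= 1.

Definition bqp_obj (R : realFieldType) (m n : nat)
    (Q : 'M[R]_(m, n)) (c : 'cV[R]_m) (d : 'cV[R]_n)
    (x : 'cV[R]_m) (y : 'cV[R]_n) : R :=
  \sum_(i < m) \sum_(j < n) Q i j * x i 0 * y j 0
  + \sum_(i < m) c i 0 * x i 0 + \sum_(j < n) d j 0 * y j 0.

(* The two steps of the RyOx algorithm started at (x, y): first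
   y* = round_y Q d x, which does not depend on y, then
   x* = optimize_x Q c y*. Ties are sent to 0. *)
Definition round_y (R : realFieldType) (m n : nat)
    (Q : 'M[R]_(m, n)) (d : 'cV[R]_n) (x : 'cV[R]_m) : 'cV[R]_n :=
  \col_(j < n) (if 0 < d j 0 + \sum_(i < m) Q i j * x i 0 then 1 else 0).

Definition optimize_x (R : realFieldType) (m n : nat)
    (Q : 'M[R]_(m, n)) (c : 'cV[R]_m) (y : 'cV[R]_n) : 'cV[R]_m :=
  \col_(i < m) (if 0 < c i 0 + \sum_(j < n) Q i j * y j 0 then 1 else 0).

(* Main.v *)
Require Import Defs.
From HB Require Import structures.
From mathcomp Require Import all_boot all_order all_algebra.
Set Implicit Arguments.
Unset Strict Implicit.
Unset Printing Implicit Defensive.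
Import Order.TTheory GRing.Theory Num.Theory.
Local Open Scope ring_scope.

(** The objective [f := bqp_obj Q c d] is bilinear plus linear terms, so with
    one block of variables fixed it is affine and separable in the other block.
    A separable affine function on the unit cube is maximized one coordinate at
    a time, by taking the indicator of a positive coefficient
    ([ler_mul_indicator_pos]).  For [x] fixed, [y' := round_y Q d x] is this
    maximizer of [f x]; for [y'] fixed, [x' := optimize_x Q c y'] is this
    maximizer of [f^~ y'].  Hence [f x y <= f x y' <= f x' y'], the two
    inequalities being [bqp_obj_round_y] and [bqp_obj_optimize_x]. *)

Lemma ler_mul_indicator_pos (R : realFieldType) (a t : R) :
  0 <= t <= 1 -> a * t <= a * (if 0 < a then 1 else 0).
Proof.
move=> /andP[t_ge0 t_le1]; case: ltP => [a_gt0 | a_le0].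
  by rewrite ler_wpM2l // ltW.
by rewrite mulr0 mulr_le0_ge0.
Qed.

Lemma bqp_obj_affine_y (R : realFieldType) (m n : nat)
    (Q : 'M[R]_(m, n)) (c : 'cV[R]_m) (d : 'cV[R]_n)
    (x : 'cV[R]_m) (y : 'cV[R]_n) :
  bqp_obj Q c d x y =
    \sum_(i < m) c i 0 * x i 0
    + \sum_(j < n) (d j 0 + \sum_(i < m) Q i j * x i 0) * y j 0.
Proof.
rewrite /bqp_obj exchange_big /= addrAC addrC; congr (_ + _).
rewrite -big_split /=; apply: eq_bigr => j _.
by rewrite -mulr_suml -mulrDl addrC.
Qed.

Lemma bqp_obj_affine_x (R : realFieldType) (m n : nat)
    (Q : 'M[R]_(m, n)) (c : 'cV[R]_m) (d : 'cV[R]_n)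
    (x : 'cV[R]_m) (y : 'cV[R]_n) :
  bqp_obj Q c d x y =
    \sum_(i < m) (c i 0 + \sum_(j < n) Q i j * y j 0) * x i 0
    + \sum_(j < n) d j 0 * y j 0.
Proof.
rewrite /bqp_obj; congr (_ + _).
rewrite -big_split /=; apply: eq_bigr => i _.
rewrite mulrDl addrC mulr_suml; congr (_ + _).
by apply: eq_bigr => j _; rewrite mulrAC.
Qed.

Lemma bqp_obj_round_y (R : realFieldType) (m n : nat)
    (Q : 'M[R]_(m, n)) (c : 'cV[R]_m) (d : 'cV[R]_n)
    (x : 'cV[R]_m) (y : 'cV[R]_n) :
  in_unit_cube y -> bqp_obj Q c d x y <= bqp_obj Q c d x (round_y Q d x).
Proof.
move=> y_cube; rewrite !bqp_obj_affine_y lerD2l.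
by apply: ler_sum => j _; rewrite mxE ler_mul_indicator_pos.
Qed.

Lemma bqp_obj_optimize_x (R : realFieldType) (m n : nat)
    (Q : 'M[R]_(m, n)) (c : 'cV[R]_m) (d : 'cV[R]_n)
    (x : 'cV[R]_m) (y : 'cV[R]_n) :
  in_unit_cube x -> bqp_obj Q c d x y <= bqp_obj Q c d (optimize_x Q c y) y.
Proof.
move=> x_cube; rewrite !bqp_obj_affine_x lerD2r.
by apply: ler_sum => i _; rewrite mxE ler_mul_indicator_pos.
Qed.

Theorem theorem9 (R : realFieldType) (m n : nat)
    (Q : 'M[R]_(m, n)) (c : 'cV[R]_m) (d : 'cV[R]_n)
    (x : 'cV[R]_m) (y : 'cV[R]_n)
    (hx : in_unit_cube x) (hy : in_unit_cube y) :
  let ystar := round_y Q d x in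
  let xstar := optimize_x Q c ystar in
  bqp_obj Q c d xstar ystar >= bqp_obj Q c d x y.
Proof.
rewrite /=; apply: le_trans (bqp_obj_round_y Q c d x hy) _.
exact: bqp_obj_optimize_x hx.
Qed.
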